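(* Let $G=(V,E)$ be a graph, $p\colon V\to\mathbb{Z}_{>0}$, and $\prec$ a total order on $V$. Then $\mathcal P(G,p)$ is full-dimensional, i.e., $\dim(\mathcal P(G,p))=n+\bar e-|S|+1$.
   Context: $n=|V|$, $\bar E$ is the edge set of the complement of $G$ and $\bar e=|\bar E|$. Let $\bar N^-(v)=\{u\in V: u\prec v,\ \{u,v\}\notin E\}$, $\bar N^+(v)=\{u\in V: v\prec u,\ \{u,v\}\notin E\}$, $\bar N^-[v]=\bar N^-(v)\cup\{v\}$, $S=\{v:\bar N^-(v)=\emptyset\}$, $T=\{v:\bar N^+(v)=\emptyset\}$. Variables: $x_{uv}$ for $v\in V$, $u\in\bar N^-(v)$, and $x_{vv}$ for $v\in V\setminus S$ (so $n+\bar e-|S|$ variables), plus a real variable $y$. $\mathcal K(v)$ is the collection of subsets of $\bar N^+(v)$ inducing a clique of size 2 in $G$ or a maximal clique of size 1 in $G[\bar N^+(v)]$. Constraints: (C1) $\sum_{u\in\bar N^-[v]}x_{uv}\ge1$ for $v\in V\setminus S$; (C2) $\sum_{u\in K}x_{vu}\le x_{vv}$ for $v\in(V\setminus T)\setminus S$, $K\in\mathcal K(v)$; (C3) $\sum_{u\in K}x_{vu}\le 1$ for $v\in(V\setminus T)\cap S$, $K\in\mathcal K(v)$; (C4) $p(v)x_{vv}+\sum_{u\in\bar N^+(v)}p(u)x_{vu}\le y$ for $v\in V\setminus S$; (C5) $p(v)+\sum_{u\in\bar N^+(v)}p(u)x_{vu}\le y$ for $v\in S$. $\mathcal P(G,p)=\operatorname{conv}\{(y,x)\in\mathbb{R}_{\ge0}\times\{0,1\}^{n+\bar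 e-|S|}:(y,x)\text{ satisfies (C1)–(C5)}\}$. *)

(* Defs.v *)
From mathcomp Require Import classical_sets reals.
From mathcomp Require Import all_boot all_order all_algebra.

Set Implicit Arguments.
Unset Strict Implicit.
Unset Printing Implicit Defensive.

Import Order.TTheory GRing.Theory Num.Theory.
Local Open Scope ring_scope.

Definition convex_hull (R : realType) (U : lmodType R) (A : set U) : set U :=
  fun x => exists (m : nat) (a : 'I_m -> R) (w : 'I_m -> U),
    [/\ forall i, 0 <= a i, \sum_(i < m) a i = 1,
        forall i, A (w i) & x = \sum_(i < m) a i *: w i].

Definition affinely_independent (R : realType) (U : lmodType R) (m : nat)
    (w : 'I_m -> U) : Prop :=
  forall a : 'I_m -> R, \sum_(i < m) a i = 0 ->
    \sum_(i < m) a i *: w i = 0 -> forall i, a i = 0.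

(* [affine_dim A d] says that the maximum number of affinely independent       *)
(* points of A is d + 1; it fails for every d when A is empty.                 *)
Definition affine_dim (R : realType) (U : lmodType R) (A : set U) (d : nat)
    : Prop :=
  (exists w : 'I_d.+1 -> U, (forall i, A (w i)) /\ affinely_independent w) /\
  (forall (m : nat) (w : 'I_m -> U),
     (forall i, A (w i)) -> affinely_independent w -> (m <= d.+1)%N).

Definition full_dimensional (R : realType) (U : vectType R) (A : set U)
    : Prop :=
  affine_dim A (\dim (@fullv R U)).

(* A simple graph on V is given by its adjacency relation e, symmetric and     *)
(* irreflexive.                                                                *)
Definition simple_graph (V : finType) (e : rel V) : Prop :=
  symmetric e /\ irreflexive e.

Definition strict_total_order (V : finType) (prec : rel V) : Prop :=
  [/\ irreflexive prec, transitive prec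
    & forall u v, u != v -> prec u v || prec v u].

Definition coedges (V : finType) (e : rel V) : {set {set V}} :=
  [set A : {set V} |
    [exists u, exists v, [&& u != v, ~~ e u v & A == [set u; v]]]].

Definition coN_in (V : finType) (e prec : rel V) (v : V) : {set V} :=
  [set u | prec u v & ~~ e u v].

Definition coN_out (V : finType) (e prec : rel V) (v : V) : {set V} :=
  [set u | prec v u & ~~ e u v].

Definition coN_in_closed (V : finType) (e prec : rel V) (v : V) : {set V} :=
  v |: coN_in e prec v.

Definition sources (V : finType) (e prec : rel V) : {set V} :=
  [set v | coN_in e prec v == set0].

Definition sinks (V : finType) (e prec : rel V) : {set V} :=
  [set v | coN_out e prec v == set0].

Definition clique (V : finType) (e : rel V) (A : {set V}) : bool :=
  [forall u in A, forall v in A, (u != v) ==> e u v].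

Definition maximal_clique_in (V : finType) (e : rel V) (W K : {set V}) : bool :=
  maxset (fun A : {set V} => (A \subset W) && clique e A) K.

Definition calK (V : finType) (e prec : rel V) (v : V) : {set {set V}} :=
  [set K : {set V} | K \subset coN_out e prec v &
     (clique e K && (#|K| == 2%N)) ||
     (maximal_clique_in e (coN_out e prec v) K && (#|K| == 1%N))].

(* The pair (u, v) is the index of the variable x_{uv}.                        *)
Definition is_var (V : finType) (e prec : rel V) (q : V * V) : bool :=
  (q.1 \in coN_in e prec q.2) || ((q.1 == q.2) && (q.2 \notin sources e prec)).

Definition xvar (V : finType) (e prec : rel V) : finType :=
  {q : V * V | is_var e prec q}.

Definition ambient (R : realType) (V : finType) (e prec : rel V) : vectType R :=
  (R^o * {ffun xvar e prec -> R^o})%type.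

(* The default value 0 is never reached in the constraints below, which only   *)
(* refer to pairs satisfying [is_var].                                         *)
Definition xcoord (R : realType) (V : finType) (e prec : rel V)
    (x : {ffun xvar e prec -> R^o}) (u v : V) : R :=
  if insub (u, v) is Some i then x i else 0.

Definition C1 (R : realType) (V : finType) (e prec : rel V)
    (x : {ffun xvar e prec -> R^o}) : Prop :=
  forall v, v \notin sources e prec ->
    1 <= \sum_(u in coN_in_closed e prec v) xcoord x u v.

Definition C2 (R : realType) (V : finType) (e prec : rel V)
    (x : {ffun xvar e prec -> R^o}) : Prop :=
  forall v, v \notin sinks e prec -> v \notin sources e prec ->
  forall K, K \in calK e prec v ->
    \sum_(u in K) xcoord x v u <= xcoord x v v.

Definition C3 (R : realType) (V : finType) (e prec : rel V)
    (x : {ffun xvar e prec -> R^o}) : Prop :=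
  forall v, v \notin sinks e prec -> v \in sources e prec ->
  forall K, K \in calK e prec v ->
    \sum_(u in K) xcoord x v u <= 1.

Definition C4 (R : realType) (V : finType) (e prec : rel V) (p : V -> nat)
    (y : R) (x : {ffun xvar e prec -> R^o}) : Prop :=
  forall v, v \notin sources e prec ->
    (p v)%:R * xcoord x v v
      + \sum_(u in coN_out e prec v) (p u)%:R * xcoord x v u <= y.

Definition C5 (R : realType) (V : finType) (e prec : rel V) (p : V -> nat)
    (y : R) (x : {ffun xvar e prec -> R^o}) : Prop :=
  forall v, v \in sources e prec ->
    (p v)%:R + \sum_(u in coN_out e prec v) (p u)%:R * xcoord x v u <= y.

Definition feasible (R : realType) (V : finType) (e prec : rel V)
    (p : V -> nat) : set (ambient R e prec) :=
  fun z => [/\ 0 <= z.1, forall i, z.2 i = 0 \/ z.2 i = 1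
    & [/\ C1 z.2, C2 z.2, C3 z.2, C4 p z.1 z.2 & C5 p z.1 z.2]].

Definition calP (R : realType) (V : finType) (e prec : rel V) (p : V -> nat)
    : set (ambient R e prec) :=
  convex_hull (@feasible R V e prec p).

(* Main.v *)
Require Import Defs.
From mathcomp Require Import classical_sets reals.
From mathcomp Require Import all_boot all_order all_algebra.

(** Fix [Y] at least the sum of all [p v] and let [x0] be the 0/1 point with
    [x_vv = 1] for all [v] and all other variables zero. The points
    [(Y, x0)], [(Y + 1, x0)], [(Y, x0 + e_uv)] for every non-edge [uv]
    with [u] preceding [v], and [(Y, x0 - e_vv + e_uv)] for every non-source [v] and one chosen
    [u] preceding and non-adjacent to [v], are feasible. Subtracting the first
    from the others leaves a family that is triangular with respect to the
    unit vectors, so these points are affinely independent, and there are as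
    many of them as the dimension of the ambient space plus one. *)

Set Implicit Arguments.
Unset Strict Implicit.
Unset Printing Implicit Defensive.

Import Order.TTheory GRing.Theory Num.Theory.
Local Open Scope ring_scope.

(** * Convex hulls and affine independence *)

Lemma sub_convex_hull (R : realType) (U : lmodType R) (A : set U) (x : U) :
  A x -> convex_hull A x.
Proof.
move=> Ax; exists 1%N, (fun=> 1), (fun=> x).
by split=> //; rewrite big_ord1 ?scale1r.
Qed.

(* Affine independence of the [w i] is linear independence of the [(1, w i)]. *)
Lemma affinely_independent_leq_dim (R : realType) (U : vectType R) (m : nat)
    (w : 'I_m -> U) :
  affinely_independent w -> (m <= (\dim (@fullv R U)).+1)%N.
Proof.
move=> indw.
have [X XE] : exists X : m.-tuple (R^o * U)%type, forall i : 'I_m, X`_i = (1, w i).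
  exists [tuple (1, w i) | i < m] => i.
  by rewrite -[LHS](tnth_nth _ _ i) tnth_mktuple.
have frX : free X.
  apply/freeP => k sk0; apply: indw.
    have := congr1 fst sk0; rewrite raddf_sum /= => sk1; rewrite -[RHS]sk1.
    by apply: eq_bigr => i _; rewrite XE /= [RHS]mulr1.
  have := congr1 snd sk0; rewrite raddf_sum /= => sk1; rewrite -[RHS]sk1.
  by apply: eq_bigr => i _; rewrite XE.
move: frX; rewrite /free size_tuple => /eqP <-.
by rewrite (leq_trans (dimvS (subvf _))) // !dimvf.
Qed.

Lemma full_dimensionalP (R : realType) (U : vectType R) (A : set U)
    (w : 'I_(\dim (@fullv R U)).+1 -> U) :
  (forall i, A (w i)) -> affinely_independent w -> full_dimensional A.
Proof.
move=> Aw indw; split; first by exists w.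
by move=> m w' _; apply: affinely_independent_leq_dim.
Qed.

(** Since the coefficients sum to 0, the base point [z] cancels and a linear relation among the
    [d i] remains; the coefficient of [z] then vanishes as well. *)
Lemma affinely_independent_translates (R : realType) (U : lmodType R) (n : nat)
    (z : U) (d : 'I_n -> U) :
  (forall a : 'I_n -> R, \sum_i a i *: d i = 0 -> forall i, a i = 0) ->
  affinely_independent
    (fun i => if unlift ord0 i is Some j then z + d j else z).
Proof.
move=> indd a; rewrite !big_ord_recl unlift_none => sa0.
under eq_bigr do rewrite liftK scalerDr.
rewrite big_split /= -scaler_suml addrA -scalerDl sa0 scale0r add0r => /indd a0.
move=> i; case: (unliftP ord0 i) => [j|] ->; first exact: a0.
by move: sa0; rewrite big1 ?addr0 // => j _; apply: a0.
Qed.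

Section Polytope.

Variables (R : realType) (V : finType) (e prec : rel V) (p : V -> nat).
Hypotheses (e_sym : symmetric e) (prec_irr : irreflexive prec).
Hypotheses (prec_tr : transitive prec).
Hypotheses (prec_total : forall u v, u != v -> prec u v || prec v u).

Local Notation inN := (coN_in e prec).
Local Notation outN := (coN_out e prec).
Local Notation var := (xvar e prec).

(** * Counting the variables *)

Lemma coN_in_neq u v : u \in inN v -> u != v.
Proof. by rewrite inE => /andP[uv _]; apply: contraTneq uv => ->; rewrite prec_irr. Qed.

Lemma coN_outE u v : (u \in outN v) = (v \in inN u).
Proof. by rewrite !inE e_sym. Qed.

(** The order gives each non-edge exactly one orientation: totality provides one, transitivity and
    irreflexivity exclude a second. *)
Lemma card_coedges : #|coedges e| = #|[set q : V * V | q.1 \in inN q.2]|.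
Proof.
have -> : coedges e =
    [set [set q.1; q.2] | q : V * V in [set q : V * V | q.1 \in inN q.2]].
  apply/setP => A; rewrite inE; apply/existsP/imsetP.
    case=> u /existsP[v /and3P[uv euv /eqP ->]].
    case/orP: (prec_total uv) => puv.
      by exists (u, v); rewrite // !inE puv euv.
    by exists (v, u); rewrite 1?finset.setUC // !inE puv e_sym euv.
  case=> -[u v] /=; rewrite inE /= => uv ->; exists u; apply/existsP; exists v.
  by rewrite (coN_in_neq uv) eqxx; move: uv; rewrite inE => /andP[_ ->].
apply: card_in_imset => -[u v] [u' v']; rewrite !inE /= => /andP[uv _] /andP[uv' _].
move=> eqA; have := set21 u v; have := set22 u v; rewrite eqA.
(* Of the four ways to match the endpoints, two make [u] and [v] equal and the crossed one gives a
   cycle of [prec]. *)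
case/set2P=> ev /set2P[] eu; rewrite -?eu -?ev // ?eu ?ev in uv uv' *.
- by rewrite prec_irr in uv.
- by have := prec_tr uv uv'; rewrite prec_irr.
- by rewrite prec_irr in uv.
Qed.

Lemma card_xvar : #|{: var}| = (#|V| + #|coedges e| - #|sources e prec|)%N.
Proof.
rewrite card_sig -addnBAC ?max_card // card_coedges.
pose D := [set (v, v) | v in ~: sources e prec].
have <- : #|D| = (#|V| - #|sources e prec|)%N.
  by rewrite card_imset => [|u v []//]; rewrite -(cardsC (sources e prec)) addKn.
(* The variables are the disjoint union of the oriented non-edges and the diagonal pairs [D]. *)
rewrite addnC -cardsUI [X in (_ = _ + X)%N](_ : _ = 0%N).
  rewrite addn0; apply: eq_card => -[u v]; rewrite !inE /is_var /= inE.
  congr (_ || _); apply/andP/imsetP => [[/eqP -> vS]|[w wS [-> ->]]].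
    by exists v; rewrite // inE.
  by rewrite eqxx; rewrite inE in wS.
apply: eq_card0 => -[u v]; rewrite inE; apply/andP => -[].
rewrite inE /= => /coN_in_neq uv /imsetP[w _ [uw vw]].
by rewrite uw vw eqxx in uv.
Qed.

Lemma dim_ambient : \dim (@fullv R (ambient R e prec)) = #|{: var}|.+1.
Proof. by rewrite dimvf; apply: (congr1 S (muln1 _)). Qed.

(** * Feasibility of 0/1 points *)

Definition indicator (f : pred (V * V)) : {ffun var -> R^o} :=
  [ffun i => (f (val i))%:R].

Lemma xcoord_indicator f u v :
  is_var e prec (u, v) -> xcoord (indicator f) u v = (f (u, v))%:R.
Proof. by move=> uv; rewrite /xcoord insubT ffunE. Qed.

Lemma is_var_out u v : u \in outN v -> is_var e prec (v, u).
Proof. by rewrite coN_outE /is_var => ->. Qed.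

Lemma is_var_diag v : v \notin sources e prec -> is_var e prec (v, v).
Proof. by rewrite /is_var eqxx => ->; rewrite orbT. Qed.

Lemma sum_bool_le1 (K : {set V}) (g : pred V) :
  {in K &, forall u u', g u -> g u' -> u = u'} ->
  \sum_(u in K) (g u)%:R <= 1 :> R.
Proof.
move=> g1; case: (pickP [pred u in K | g u]) => [u /= /andP[uK gu]|g0].
  rewrite (bigD1 u) //= gu big1 ?addr0 // => u' /andP[u'K u'u].
  by case gu': (g u') => //; rewrite (g1 u u') ?eqxx in u'u.
by rewrite big1 ?ler01 // => u uK; move: (g0 u); rewrite /= uK /= => ->.
Qed.

(** [v] is not its own out-neighbour, so each [p u] is counted at most once. The separate [b] serves
    both C4, as the value of [x_vv], and C5, as [true]. *)
Lemma load_le_total v (f : pred (V * V)) (b : bool) :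
  (p v)%:R * b%:R + \sum_(u in outN v) (p u)%:R * (f (v, u))%:R
    <= (\sum_u p u)%:R :> R.
Proof.
have le_natb (m : nat) (c : bool) : m%:R * c%:R <= m%:R :> R.
  by case: c; rewrite ?mulr1 ?mulr0 ?ler0n.
rewrite [in leRHS](bigD1 v) //= natrD natr_sum lerD // big_mkcond [leRHS]big_mkcond /=.
apply: ler_sum => u _; case: ifP => [|_]; last by case: ifP => _; rewrite ?ler0n.
by rewrite coN_outE => /coN_in_neq; rewrite eq_sym => ->; apply: le_natb.
Qed.

(** The hypotheses are combinatorial forms of the constraints: every non-source is covered (C1), at
    most one [x_vu] per [v] is 1 (C3), and for a non-source only if [x_vv] is 1 (with the former,
    C2). The bound on [y] gives C4 and C5. *)
Lemma feasible_indicator (f : pred (V * V)) (y : R) :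
  (forall v, v \notin sources e prec ->
     exists2 u, u \in coN_in_closed e prec v & f (u, v)) ->
  (forall v u, v \notin sources e prec -> u \in outN v -> f (v, u) -> f (v, v)) ->
  (forall v, {in outN v &, forall u u', f (v, u) -> f (v, u') -> u = u'}) ->
  (\sum_v p v)%:R <= y ->
  feasible p ((y, indicator f) : ambient R e prec).
Proof.
move=> cov opn one ley.
have sumE v (K : {set V}) (c : V -> R) : K \subset outN v ->
    \sum_(u in K) c u * xcoord (indicator f) v u =
    \sum_(u in K) c u * (f (v, u))%:R.
  move=> /subsetP sK; apply: eq_bigr => u /sK uv.
  by rewrite xcoord_indicator // is_var_out.
have sum1 v K : K \in calK e prec v ->
    \sum_(u in K) xcoord (indicator f) v u = \sum_(u in K) (f (v, u))%:R.
  rewrite inE => /andP[sK _]; have := sumE v K (fun=> 1) sK.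
  by under eq_bigr do rewrite mul1r; under [RHS]eq_bigr do rewrite mul1r.
have le1 v K : K \in calK e prec v -> \sum_(u in K) (f (v, u))%:R <= 1 :> R.
  rewrite inE => /andP[/subsetP sK _]; apply: sum_bool_le1 => u u' /sK uv /sK.
  exact: one.
split=> /=; first by rewrite (le_trans _ ley) ?ler0n.
  by move=> i; rewrite ffunE; case: (f _); [right | left].
split=> v.
- move=> vS; have [u uv fuv] := cov v vS.
  have var_in w : w \in coN_in_closed e prec v -> is_var e prec (w, v).
    by case/setU1P=> [->|wv]; [apply: is_var_diag | rewrite /is_var wv].
  rewrite (bigD1 u) //= xcoord_indicator ?var_in // fuv lerDl.
  apply: sumr_ge0 => w /andP[wv _].
  by rewrite xcoord_indicator ?var_in ?ler0n.
- move=> _ vS K KK; rewrite sum1 // xcoord_indicator ?is_var_diag //.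
  case fvv: (f (v, v)); first exact: le1.
  rewrite big1 // => u uK; case fvu: (f (v, u)) => //.
  move: KK; rewrite inE => /andP[/subsetP/(_ u uK) uv _].
  by rewrite (opn v u) in fvv.
- by move=> _ _ K KK; rewrite sum1 ?le1.
- move=> vS; rewrite sumE // xcoord_indicator ?is_var_diag //.
  exact: le_trans (load_le_total _ _ _) ley.
- move=> vS; rewrite sumE // -[X in X + _]mulr1.
  exact: le_trans (load_le_total v f true) ley.
Qed.

(** * The affinely independent family *)

Definition diag : pred (V * V) := fun r => r.1 == r.2.

Definition in_neighbour (q : V * V) : V :=
  if diag q then odflt q.1 [pick u in inN q.2] else q.1.

Lemma in_neighbourP q : is_var e prec q -> in_neighbour q \in inN q.2.
Proof.
rewrite /is_var /in_neighbour /diag; case: q => u v /=.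
case: eqP => [->|_]; last by rewrite orbF.
(* A diagonal pair is a variable only at a non-source, so [pick] succeeds and the default is never
   reached. *)
rewrite andTb => vv; have vS : v \notin sources e prec.
  by case/orP: vv => // /coN_in_neq; rewrite eqxx.
case: pickP => //= w0; move: vS; rewrite inE => /set0Pn[w].
by rewrite w0.
Qed.

(* For off-diagonal [q] this is [x0 + e_q]; for [q = (v, v)] it is
   [x0 - e_vv + e_uv] with [u] the chosen in-neighbour. *)
Definition swap (q : V * V) : pred (V * V) :=
  fun r => diag r && (r != q) || (r == (in_neighbour q, q.2)).

Lemma feasible_diag (y : R) : (\sum_v p v)%:R <= y ->
  feasible p ((y, indicator diag) : ambient R e prec).
Proof.
apply: feasible_indicator => [v _|v u _ _ _|v u u']; rewrite /diag /= ?eqxx //.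
  by exists v; rewrite ?eqxx // setU11.
by move=> _ _ /eqP <- /eqP <-.
Qed.

(** The only off-diagonal entry set to 1 is at [(in_neighbour q, q.2)]. It covers [q.2], and its
    tail differs from [q.2], so the diagonal entry there is still 1. All other vertices cover
    themselves. *)
Lemma feasible_swap (q : V * V) (y : R) : is_var e prec q ->
  (\sum_v p v)%:R <= y ->
  feasible p ((y, indicator (swap q)) : ambient R e prec).
Proof.
case: q => a b var_q.
have nin := in_neighbourP var_q; rewrite /= in nin.
have swap_out v u : u \in outN v -> swap (a, b) (v, u) ->
    v = in_neighbour (a, b) /\ u = b.
  rewrite coN_outE /swap /diag /= => /coN_in_neq /negPf -> /=.
  by rewrite xpair_eqE => /andP[/eqP -> /eqP ->].
apply: feasible_indicator => [v vS|v u vS uv suv|v u u' uv u'v].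
- have [->|vb] := eqVneq v b.
    exists (in_neighbour (a, b)); last by rewrite /swap eqxx orbT.
    by rewrite /coN_in_closed in_setU1 nin orbT.
  exists v; first exact: setU11.
  by rewrite /swap /diag eqxx xpair_eqE (negPf vb) andbF.
- have [-> _] := swap_out v u uv suv.
  by rewrite /swap /diag eqxx xpair_eqE (negPf (coN_in_neq nin)) andbF.
- by move=> /swap_out-[]// _ -> /swap_out-[]// _ ->.
Qed.

Lemma swap_diag (q r : V * V) : is_var e prec q -> diag r ->
  (swap q r)%:R - (diag r)%:R = - (r == q)%:R :> R.
Proof.
move=> /in_neighbourP/coN_in_neq nq dr; rewrite /swap dr andTb.
have /negPf -> : r != (in_neighbour q, q.2).
  by apply: contraTneq dr => ->.
by rewrite orbF; case: eqP => _; rewrite ?subrr ?sub0r ?oppr0.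
Qed.

Lemma swap_offdiag (q r : V * V) : ~~ diag q -> ~~ diag r ->
  (swap q r)%:R - (diag r)%:R = (r == q)%:R :> R.
Proof.
move=> dq /negPf dr; rewrite /swap dr /in_neighbour (negPf dq) subr0.
by case: q {dq} => u v.
Qed.

(** Triangularity: by [swap_diag], a diagonal coordinate [r] sees only the term of index [r], with
    coefficient -1. Once the diagonal coefficients vanish, [swap_offdiag] isolates each remaining
    one. *)
Lemma swap_independent (a : var -> R) :
  \sum_i a i *: (indicator (swap (val i)) - indicator diag) = 0 ->
  forall i, a i = 0.
Proof.
move=> sa0.
have coord (r : var) :
    \sum_i a i * ((swap (val i) (val r))%:R - (diag (val r))%:R) = 0.
  have := congr1 (fun f : {ffun var -> R^o} => f r) sa0; rewrite sum_ffunE ffunE => sar.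
  by rewrite -[RHS]sar; apply: eq_bigr => i _; rewrite !ffunE.
have a_diag (r : var) : diag (val r) -> a r = 0.
  move=> dr; have := coord r; rewrite (bigD1 r) //= big1 => [|i ir].
    rewrite addr0 swap_diag ?valP // eqxx mulrN1 => /eqP.
    by rewrite oppr_eq0 => /eqP.
  by rewrite swap_diag ?valP // val_eqE eq_sym (negPf ir) oppr0 mulr0.
move=> r; have [/a_diag//|dr] := boolP (diag (val r)).
have := coord r; rewrite (bigD1 r) //= big1 => [|i ir].
  by rewrite addr0 swap_offdiag // eqxx mulr1.
have [/a_diag ->|di] := boolP (diag (val i)); first by rewrite mul0r.
by rewrite swap_offdiag // val_eqE eq_sym (negPf ir) mulr0.
Qed.

Lemma full_dimensional_calP : full_dimensional (@calP R V e prec p).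
Proof.
pose Y : R := (\sum_v p v)%:R.
pose z : ambient R e prec := (Y, indicator diag).
(* Index 0 is the direction of [y]; the others run through the variables. *)
pose d (j : 'I_#|{: var}|.+1) : ambient R e prec :=
  if unlift ord0 j is Some k
  then (0, indicator (swap (val (enum_val k))) - indicator diag) else (1, 0).
pose w (i : 'I_#|{: var}|.+2) := if unlift ord0 i is Some j then z + d j else z.
have Pw i : @calP R V e prec p (w i).
  apply: sub_convex_hull; rewrite /w.
  case: (unliftP ord0 i) => [j _|_]; last exact: feasible_diag.
  rewrite /d; case: (unliftP ord0 j) => [k _|_].
    suff -> : z + (0, indicator (swap (val (enum_val k))) - indicator diag) =
              (Y, indicator (swap (val (enum_val k)))).
      by apply: feasible_swap => //; apply: valP.
    by congr pair; rewrite /= ?addr0 // addrC subrK.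
  suff -> : z + (1, 0) = (Y + 1, indicator diag).
    by apply: feasible_diag; rewrite lerDl ler01.
  by congr pair; rewrite /= addr0.
have indw : affinely_independent w.
  apply: affinely_independent_translates => a.
  rewrite big_ord_recl /d unlift_none; under eq_bigr do rewrite liftK.
  (* Only [d ord0] moves [y], so the first component kills its coefficient; the second is a relation
     among the differences of indicators. *)
  move=> sa; have := congr1 fst sa; have := congr1 snd sa.
  rewrite /= !raddf_sum /= scaler0 add0r => sa2.
  rewrite big1 => [|k _]; last by rewrite scaler0.
  rewrite addr0 => /eqP; rewrite mulf_eq0 oner_eq0 orbF => /eqP a0.
  have a1 : forall i, a (lift ord0 (enum_rank i)) = 0.
    apply: swap_independent; rewrite -[RHS]sa2.
    rewrite (reindex_onto enum_val enum_rank) /=; last by move=> i _; rewrite enum_rankK.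
    by apply: eq_big => [k|k _]; rewrite enum_valK ?eqxx.
  move=> j; case: (unliftP ord0 j) => [k|] -> //.
  by rewrite -(enum_valK k).
(* Rewriting turns the index type of [w] into the one given by the ambient dimension. *)
move: w Pw indw; rewrite -dim_ambient => w; exact: full_dimensionalP.
Qed.

End Polytope.

Theorem theorem1 (R : realType) (V : finType) (e : rel V)
    (he : simple_graph e)
    (p : V -> nat) (hp : forall v : V, (0 < p v)%N)
    (prec : rel V) (hprec : strict_total_order prec) :
  full_dimensional (@calP R V e prec p) /\
  affine_dim (@calP R V e prec p)
    ((#|V| + #|coedges e| - #|sources e prec|) + 1)%N.
Proof.
have [[e_sym _] [prec_irr prec_tr prec_total]] := (he, hprec).
have fullP := full_dimensional_calP R p e_sym prec_irr.
(* Both claims agree once the ambient dimension is computed; the final 1 is the coordinate [y]. *)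
split=> //; move: fullP.
by rewrite /full_dimensional dim_ambient card_xvar // addn1.
Qed.
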